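(* Let $n,k,r,d$ be integers with $n\ge k\ge r>d\ge 0$. Then $${n\brace k}_{r,d} = {n-d\brace k-d}_{r-d}.$$
   Context: For non-negative integers $n,k,r,d$ with $n\ge r$, ${n\brace k}_{r,d}$ (the $(r,d)$-Stirling number of the second kind) denotes the number of partitions of $\{1,\dots,n\}$ into $k$ non-empty subsets such that the elements $1,\dots,r$ lie in pairwise different subsets and any two distinct elements $i,j$ in the same subset satisfy $|i-j|>d$. For $n\ge r$, ${n\brace k}_{r}$ (the $r$-Stirling number of the second kind) denotes the number of partitions of $\{1,\dots,n\}$ into $k$ non-empty subsets such that $1,\dots,r$ lie in pairwise different subsets. *)

(* Defs.v *)
From mathcomp Require Import all_boot all_order all_algebra.

Set Implicit Arguments.
Unset Strict Implicit.
Unset Printing Implicit Defensive.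

(* The set {1, ..., n} is 'I_n, with i.+1 represented by the ordinal of value
   i: "1, ..., r" are the i : 'I_n with i < r, and distances are unchanged. *)

Definition separates_first (n r : nat) (P : {set {set 'I_n}}) : bool :=
  [forall i : 'I_n, forall j : 'I_n,
    [&& i < r, j < r & i != j] ==> (pblock P i != pblock P j)].

(* `|i - j| is the distance in nat, not truncated subtraction. *)
Definition distant (n d : nat) (P : {set {set 'I_n}}) : bool :=
  [forall B in P, forall i in B, forall j in B,
    (i != j) ==> (d < `|(i : nat) - (j : nat)|)].

(* Both numbers are meant for r <= n. *)
Definition rd_stirling2 (n k r d : nat) : nat :=
  #|[set P : {set {set 'I_n}} |
      [&& partition P [set: 'I_n], #|P| == k, separates_first r P
        & distant d P]]|.

Definition r_stirling2 (n k r : nat) : nat :=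
  #|[set P : {set {set 'I_n}} |
      [&& partition P [set: 'I_n], #|P| == k & separates_first r P]]|.

(* Main.v *)
Require Import Defs.
From mathcomp Require Import all_boot all_order all_algebra.
From mathcomp Require Import zify.

Set Implicit Arguments.
Unset Strict Implicit.
Unset Printing Implicit Defensive.

(** Draw a partition as its arc diagram: one arc [(i, j)], [i < j], for each
    pair of elements that are consecutive in a common block.  At most one arc
    starts, and at most one arc ends, at a given point, and every set of
    increasing arcs with these two properties comes from exactly one partition,
    whose blocks are the maximal chains of arcs ([arcs_inj], [arcs_surj]).

    All the data of the theorem can be read off the diagram.  Each block has one
    point fewer on the right of an arc than it has elements, so [k] blocks means
    [n - k] arcs.  Two elements [i < j] of a block are joined by a chain whose
    last arc starts at or after [i] and ends at [j]; hence the distances in all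
    blocks exceed [d] as soon as the arcs are longer than [d], and the first [r]
    elements are separated exactly when no arc ends among them.

    Now move the right end of each arc to the left by [d] places, leaving the
    left end fixed.  Arcs longer than [d] on [n] points become arbitrary
    increasing arcs on [n - d] points, right ends beyond the first [r] points
    become right ends beyond the first [r - d], no two ends of the same kind
    are merged, and the number of arcs does not change.  As
    [n - k = (n - d) - (k - d)], this bijection ([card_diagrams_shift]) is the
    theorem. *)

(** * Arc diagrams and their chains *)

(** The bounds [d] and [r] are those of the Stirling numbers: an arc has length
    more than [d], and its right end is not among the first [r] points.  For
    [d = 0] the first one only says that arcs go from left to right. *)
Definition arc_diagram (n r d : nat) (A : {set 'I_n * 'I_n}) : bool :=
  [&& [forall e in A, (e.1 + d < e.2) && (r <= e.2)],
      dinjectiveb fst A & dinjectiveb snd A].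

Lemma arc_diagramP (n r d : nat) (A : {set 'I_n * 'I_n}) :
  reflect [/\ forall i j, (i, j) \in A -> i + d < j /\ r <= j,
              forall i j j', (i, j) \in A -> (i, j') \in A -> j = j'
            & forall i i' j, (i, j) \in A -> (i', j) \in A -> i = i']
          (arc_diagram r d A).
Proof.
apply: (iffP and3P) => [[/'forall_implyP H1 /dinjectiveP H2 /dinjectiveP H3]
                       |[H1 H2 H3]]; split.
- by move=> i j /H1 /andP.
- by move=> i j j' h h'; case: (H2 _ _ h h' erefl).
- by move=> i i' j h h'; case: (H3 _ _ h h' erefl).
- by apply/'forall_implyP => -[i j] /H1 /andP.
- apply/dinjectiveP => -[i j] [i' j'] h h' /= eii'; subst i'.
  by rewrite (H2 i j j').
- apply/dinjectiveP => -[i j] [i' j'] h h' /= ejj'; subst j'.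
  by rewrite (H3 i i' j).
Qed.

Definition chain (n : nat) (A : {set 'I_n * 'I_n}) : rel 'I_n :=
  connect (fun x y => (x, y) \in A).

Definition linked (n : nat) (A : {set 'I_n * 'I_n}) : rel 'I_n :=
  fun x y => chain A x y || chain A y x.

(** A relation with at most one predecessor per point has a single backward
    walk from each point, so of two walks into [z] one extends the other. *)
Lemma connect_comparable (T : finType) (e : rel T) (x y z : T) :
  (forall u v w, e u w -> e v w -> u = v) ->
  connect e x z -> connect e y z -> connect e x y || connect e y x.
Proof.
move=> inj_e /connectP[p]; elim/last_ind: p z => [|p w IHp] z /=.
  by move=> _ -> ->; rewrite orbT.
rewrite rcons_path last_rcons => /andP[ep eps] ->.
case/connectP=> q; case/lastP: q => [|q w'] /=.
  move=> _ <-; apply/orP; left; apply/connectP; exists (rcons p w).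
    by rewrite rcons_path ep.
  by rewrite last_rcons.
rewrite rcons_path last_rcons => /andP[eq eqs] ww'; subst w'.
apply: (IHp (last x p)) => //; rewrite (inj_e _ _ _ eps eqs).
by apply/connectP; exists q.
Qed.

Lemma connect_step (T : finType) (e : rel T) (x y : T) :
  connect e x y -> x != y -> exists2 z, e x z & connect e z y.
Proof.
case/connectP=> -[|z p] /= => [_ -> /eqP //|/andP[exz ep] -> _].
by exists z => //; apply/connectP; exists p.
Qed.

Section ArcDiagram.

Variables (n r d : nat) (A : {set 'I_n * 'I_n}).
Hypothesis diagA : arc_diagram r d A.

Lemma chain_leq (x y : 'I_n) : chain A x y -> x <= y.
Proof.
case/arc_diagramP: diagA => incA _ _.
case/connectP=> p; elim: p x => [|z p IHp] x /= => [_ -> //|].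
by case/andP=> /incA[] + _ /IHp h /h; lia.
Qed.

(** Transitivity is the point.  Two chains with a common end are nested because
    left ends are determined by right ends; two chains with a common start are
    nested by the same argument on reversed arcs. *)
Lemma linked_equiv : {in [set: 'I_n] & &, equivalence_rel (linked A)}.
Proof.
case/arc_diagramP: diagA => _ injr injl.
have in_cmp x y z : chain A x z -> chain A y z -> linked A x y.
  by apply: connect_comparable => u v w; apply: injl.
have out_cmp x y z : chain A z x -> chain A z y -> linked A x y.
  have rev u v : chain A u v = connect (fun a b => (b, a) \in A) v u.
    by rewrite (connect_rev (fun a b => (a, b) \in A)).
  rewrite /linked orbC !rev.
  by apply: connect_comparable => u v w; apply: injr.
have sym x y : linked A x y = linked A y x by rewrite /linked orbC.
have trans y x z : linked A x y -> linked A y z -> linked A x z.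
  case/orP=> xy /orP[] yz.
  - by rewrite /linked /chain (connect_trans xy yz).
  - exact: in_cmp xy yz.
  - exact: out_cmp xy yz.
  - by rewrite /linked /chain (connect_trans yz xy) orbT.
move=> x y z _ _ _; split; first by rewrite /linked /chain connect0.
move=> xy; apply/idP/idP; last exact: trans.
by apply: trans; rewrite sym.
Qed.

End ArcDiagram.

(** * The arc diagram of a partition *)

Definition arcs (n : nat) (P : {set {set 'I_n}}) : {set 'I_n * 'I_n} :=
  [set e : 'I_n * 'I_n | [&& e.1 < e.2, e.2 \in pblock P e.1
    & [forall l : 'I_n, (e.1 < l < e.2) ==> (l \notin pblock P e.1)]]].

Lemma arcsP (n : nat) (P : {set {set 'I_n}}) (i j : 'I_n) :
  reflect [/\ i < j, j \in pblock P i
            & forall l : 'I_n, i < l < j -> l \notin pblock P i]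
          ((i, j) \in arcs P).
Proof.
rewrite inE /=; apply: (iffP and3P) => -[H1 H2 H3]; split=> //.
  exact/'forall_implyP.
by apply/'forall_implyP.
Qed.

Section Partition.

Variables (n : nat) (P : {set {set 'I_n}}).
Hypothesis partP : partition P [set: 'I_n].

Lemma mem_pblock_self (i : 'I_n) : i \in pblock P i.
Proof. by rewrite mem_pblock (cover_partition partP) inE. Qed.

Lemma mem_pblockE (i j : 'I_n) : (j \in pblock P i) = (pblock P i == pblock P j).
Proof.
have tiP := partition_trivIset partP.
by rewrite eq_pblock // (cover_partition partP) inE.
Qed.

Lemma mem_pblockC (i j : 'I_n) : (j \in pblock P i) = (i \in pblock P j).
Proof. by rewrite !mem_pblockE eq_sym. Qed.

Lemma mem_pblock_trans (j i k : 'I_n) :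
  j \in pblock P i -> k \in pblock P j -> k \in pblock P i.
Proof. by rewrite !mem_pblockE => /eqP->. Qed.

(** The tool for passing from an arbitrary pair in a block to an arc: the left
    end is the element of the block that comes just before [j]. *)
Lemma last_arc (i j : 'I_n) : i < j -> j \in pblock P i ->
  exists l : 'I_n, [/\ i <= l, l \in pblock P i & (l, j) \in arcs P].
Proof.
move=> lt_ij Bij; pose Q := [pred l : 'I_n | (l \in pblock P i) && (l < j)].
have Qi : Q i by rewrite /= mem_pblock_self.
case: (@arg_maxnP _ i Q (fun l : 'I_n => l : nat) Qi) => l /andP[Bil lt_lj] lmax.
exists l; split=> //; first exact: lmax.
apply/arcsP; split=> // [|k /andP[lt_lk lt_kj]].
  by apply: mem_pblock_trans Bij; rewrite mem_pblockC.
apply/negP => Blk; have /lmax : Q k by rewrite /= lt_kj (mem_pblock_trans Bil).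
by rewrite /= leqNgt lt_lk.
Qed.

Lemma arcs_injr (i j j' : 'I_n) :
  (i, j) \in arcs P -> (i, j') \in arcs P -> j = j'.
Proof.
case/arcsP=> ij Bij gap /arcsP[ij' Bij' gap']; apply/val_inj/eqP => /=.
case: ltngtP => // h.
  by have := gap' j; rewrite ij h Bij => /(_ isT).
by have := gap j'; rewrite ij' h Bij' => /(_ isT).
Qed.

Lemma arcs_injl (i i' j : 'I_n) :
  (i, j) \in arcs P -> (i', j) \in arcs P -> i = i'.
Proof.
case/arcsP=> ij Bij gap /arcsP[ij' Bij' gap']; apply/val_inj/eqP => /=.
have Bii' : i' \in pblock P i by apply: mem_pblock_trans Bij _; rewrite mem_pblockC.
case: ltngtP => // h.
  by have := gap i'; rewrite h ij' Bii' => /(_ isT).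
by have := gap' i; rewrite h ij mem_pblockC Bii' => /(_ isT).
Qed.

(** Peel off the last arc and continue from its left end, which is still at or
    after [i]. *)
Lemma chain_arcs (i j : 'I_n) : i <= j -> j \in pblock P i -> chain (arcs P) i j.
Proof.
elim/ltn_ind: {j}(j : nat) {-2}j (erefl (j : nat)) => m IHm j jm.
rewrite leq_eqVlt => /orP[/eqP/val_inj -> _|lt_ij Bij]; first exact: connect0.
have [l [le_il Bil lj]] := last_arc lt_ij Bij.
apply: connect_trans (connect1 lj); apply: IHm le_il Bil; last by [].
by rewrite -jm; case/arcsP: lj.
Qed.

Lemma pblock_linked (i j : 'I_n) : (j \in pblock P i) = linked (arcs P) i j.
Proof.
have sub x y : chain (arcs P) x y -> y \in pblock P x.
  case/connectP=> p; elim: p x => [|z p IHp] x /= => [_ ->|].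
    exact: mem_pblock_self.
  by case/andP=> /arcsP[_ Bxz _] /IHp h /h; apply: mem_pblock_trans.
apply/idP/idP => [Bij|/orP[/sub //|/sub]]; last by rewrite mem_pblockC.
apply/orP; case/orP: (leq_total i j) => le; [left | right].
  exact: chain_arcs.
by apply: chain_arcs => //; rewrite mem_pblockC.
Qed.

(** Blocks are recovered as the classes of [linked], so the diagram determines
    the partition. *)
Lemma partition_arcs :
  P = equivalence_partition (linked (arcs P)) [set: 'I_n].
Proof.
rewrite -[LHS](equivalence_partition_pblock partP).
apply: eq_imset => x; apply/setP => y.
by rewrite !inE pblock_linked.
Qed.

(** Right ends of arcs are the elements that are not the least of their block,
    and least elements are in bijection with blocks. *)
Lemma card_arcs : #|arcs P| + #|P| = n.
Proof.
pose least := [set j : 'I_n | [forall i : 'I_n, (i < j) ==> (i \notin pblock P j)]].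
have ends : [set e.2 | e in arcs P] = ~: least.
  apply/setP => j; rewrite !inE negb_forall; apply/imsetP/existsP.
    case=> -[i j'] /arcsP[ij Bij _] /= ->; exists i.
    by rewrite negb_imply ij negbK mem_pblockC.
  case=> i; rewrite negb_imply negbK mem_pblockC => /andP[ij Bij].
  by have [l [_ _ lj]] := last_arc ij Bij; exists (l, j).
have blocks : [set pblock P j | j in least] = P.
  apply/setP => B; apply/imsetP/idP => [[j _ ->]|PB].
    by apply: pblock_mem; rewrite (cover_partition partP) inE.
  have [x Bx] := set0Pn _ (partition_neq0 partP PB).
  case: (@arg_minnP _ x (mem B) (fun l : 'I_n => l : nat) Bx) => j Bj jmin.
  have Bdef := def_pblock (partition_trivIset partP) PB Bj.
  exists j => //; rewrite inE; apply/'forall_implyP => i ij.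
  by rewrite Bdef; apply/negP => /jmin; rewrite leqNgt ij.
have -> : #|P| = #|least|.
  rewrite -blocks card_in_imset // => i j; rewrite !inE => /'forall_implyP li /'forall_implyP lj /eqP Bij.
  have Bij' : j \in pblock P i by rewrite mem_pblockE.
  apply/val_inj/eqP => /=; case: ltngtP => // h.
    by have := lj i h; rewrite mem_pblockC Bij'.
  by have := li j h; rewrite Bij'.
rewrite -(card_in_imset (f := snd)); last first.
  by move=> [i j] [i' j'] h h' /= e; subst j'; rewrite (arcs_injl h h').
by rewrite ends addnC cardsC card_ord.
Qed.

(** Consecutive elements are the extreme case of both conditions: for [i < j] in
    a block, the arc ending at [j] has the same right end as the pair [(i, j)]
    and is at most as long. *)
Lemma arcs_diagramE (r d : nat) :
  arc_diagram r d (arcs P) = separates_first r P && distant d P.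
Proof.
apply/arc_diagramP/andP => [[inc _ _]|[/forallP sep /forallP dst]].
  have bnd (i j : 'I_n) : i < j -> j \in pblock P i -> i + d < j /\ r <= j.
    move=> ij Bij; have [l [il _ /inc[]]] := last_arc ij Bij.
    by split=> //; apply: leq_ltn_trans (leq_add il (leqnn d)) _.
  split.
    apply/forallP => i; apply/'forall_implyP => j /and3P[ir jr nij].
    rewrite -mem_pblockE; apply/negP => Bij.
    move: nij; rewrite -val_eqE /= neq_ltn => /orP[] h.
      by have [_] := bnd _ _ h Bij; rewrite leqNgt jr.
    by have [_] := bnd _ _ h (etrans (mem_pblockC _ _) Bij); rewrite leqNgt ir.
  apply/'forall_implyP => B PB; apply/'forall_implyP => i Bi.
  apply/'forall_implyP => j Bj; apply/implyP.
  have Bdef := def_pblock (partition_trivIset partP) PB Bi.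
  have Bij : j \in pblock P i by rewrite Bdef.
  rewrite -val_eqE /= neq_ltn => /orP[] h.
    by have [] := bnd _ _ h Bij; lia.
  by have [] := bnd _ _ h (etrans (mem_pblockC _ _) Bij); lia.
split; [|exact: arcs_injr|exact: arcs_injl].
move=> i j /arcsP[ij Bij _]; have nij : i != j by rewrite -val_eqE /= neq_ltn ij.
split.
  have PB : pblock P i \in P by apply: pblock_mem; rewrite (cover_partition partP) inE.
  move/implyP: (dst (pblock P i)) => /(_ PB) /'forall_implyP /(_ i (mem_pblock_self i)).
  by move=> /'forall_implyP /(_ j Bij) /implyP /(_ nij); lia.
rewrite leqNgt; apply/negP => jr.
move/'forall_implyP: (sep i) => /(_ j); rewrite jr nij (ltn_trans ij jr) => /(_ isT).
by rewrite -mem_pblockE Bij.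
Qed.

End Partition.

Lemma arcs_inj (n : nat) :
  {in [pred P | partition P [set: 'I_n]] &, injective (@arcs n)}.
Proof.
by move=> P Q partP partQ eqA; rewrite (partition_arcs partP) eqA -partition_arcs.
Qed.

(** The classes of [linked A] have arcs [A]: a chain from [i] to [j] visits only
    points between them, so it has a single arc when [i] and [j] are
    consecutive; conversely, if [(i, j)] is in [A], every chain leaving [i]
    begins with it, so no point strictly between [i] and [j] is in the class. *)
Lemma arcs_surj (n r d : nat) (A : {set 'I_n * 'I_n}) : arc_diagram r d A ->
  exists2 P, partition P [set: 'I_n] & arcs P = A.
Proof.
move=> diagA; have eqvA := linked_equiv diagA.
case/arc_diagramP: (diagA) => inc injr _.
exists (equivalence_partition (linked A) [set: 'I_n]).
  exact: equivalence_partitionP.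
have blockE x y :
    (y \in pblock (equivalence_partition (linked A) [set: 'I_n]) x) = linked A x y.
  by rewrite pblock_equivalence_partition ?inE.
have linked_chain (x y : 'I_n) : x < y -> linked A x y -> chain A x y.
  by move=> xy /orP[//|/(chain_leq diagA)]; rewrite leqNgt xy.
apply/setP => -[i j]; apply/arcsP/idP => [[ij]|Aij].
  rewrite blockE => /(linked_chain _ _ ij) cij gap.
  have [|z Aiz czj] := connect_step cij; first by rewrite -val_eqE /= neq_ltn ij.
  have := chain_leq diagA czj; rewrite leq_eqVlt => /orP[/eqP/val_inj <- //|zj].
  have [iz _] := inc _ _ Aiz.
  have := gap z; rewrite zj blockE /linked /chain (connect1 Aiz) /= => /(_ _).
  by rewrite andbT (leq_ltn_trans (leq_addr d i) iz) => /(_ isT).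
have [ij _] := inc _ _ Aij; split.
- exact: leq_ltn_trans (leq_addr d i) ij.
- by rewrite blockE /linked /chain connect1.
move=> l /andP[il lj]; rewrite blockE; apply/negP => /(linked_chain _ _ il) cil.
have [|z Aiz czl] := connect_step cil; first by rewrite -val_eqE /= neq_ltn il.
by have := chain_leq diagA czl; rewrite (injr _ _ _ Aiz Aij) leqNgt lj.
Qed.

(** * Counting by arc diagrams *)

Definition diagrams (n s r d : nat) : {set {set 'I_n * 'I_n}} :=
  [set A | arc_diagram r d A & #|A| == s].

Lemma rd_stirling2_diagrams (n k r d : nat) : k <= n ->
  rd_stirling2 n k r d = #|diagrams n (n - k) r d|.
Proof.
move=> le_kn; rewrite /rd_stirling2 -(card_in_imset (f := @arcs n)); last first.
  by move=> P Q; rewrite !inE => /andP[hP _] /andP[hQ _]; apply: arcs_inj.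
have cardE P : partition P [set: 'I_n] -> (#|arcs P| == n - k) = (#|P| == k).
  by move=> /card_arcs; lia.
congr #|pred_of_set _|; apply/setP => A; rewrite inE; apply/imsetP/andP.
  case=> P; rewrite inE => /and3P[partP cP sd] ->.
  by rewrite arcs_diagramE // cardE.
case=> diagA cA; have [P partP defA] := arcs_surj diagA.
by exists P; rewrite // inE partP -cardE // defA cA -arcs_diagramE // defA.
Qed.

Lemma r_stirling2E (n k r : nat) : r_stirling2 n k r = rd_stirling2 n k r 0.
Proof.
congr #|pred_of_set _|; apply/setP => P; rewrite !inE.
suff -> : distant 0 P by rewrite andbT.
apply/'forall_implyP => B _; apply/'forall_implyP => i _.
apply/'forall_implyP => j _; apply/implyP; rewrite -val_eqE /=; lia.
Qed.

(** * Shifting the right ends *)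

(** The shift is taken upwards, from the smaller set of points to the larger,
    because in this direction it is defined on every pair; its image contains
    every pair [(i, j)] with [i + d < j]. *)
Definition stretch (d m : nat) (e : 'I_m * 'I_m) : 'I_(d + m) * 'I_(d + m) :=
  (widen_ord (leq_addl d m) e.1, rshift d e.2).

Lemma stretch_inj (d m : nat) : injective (@stretch d m).
Proof.
move=> [i j] [i' j'] [] /val_inj /= -> /eqP; rewrite eqn_add2l => /eqP e.
by congr pair; apply: val_inj.
Qed.

(** Stretching all arcs of a diagram maps distinct arcs to distinct arcs, and its
    image consists of all diagrams whose arcs are long enough; the inverse map
    is the preimage by [stretch]. *)
Lemma card_diagrams_shift (d m s r : nat) :
  #|diagrams (d + m) s r d| = #|diagrams m s (r - d) 0|.
Proof.
have inj := @stretch_inj d m.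
rewrite -(card_imset _ (imset_inj inj)); congr #|pred_of_set _|.
apply/setP => A; apply/idP/imsetP => [|[A']].
  rewrite inE => /andP[/arc_diagramP[inc injr injl] cA].
  have defA : A = [set stretch d e | e in @stretch d m @^-1: A].
    apply/setP => -[i j]; apply/idP/imsetP => [Aij|[e]]; last by rewrite inE => h ->.
    have [ij _] := inc _ _ Aij; have lt_jn := ltn_ord j.
    have lt_im : i < m by lia.
    have lt_jm : j - d < m by lia.
    have defij : (i, j) = stretch d (Ordinal lt_im, Ordinal lt_jm).
      by congr pair; apply: val_inj => //=; lia.
    by exists (Ordinal lt_im, Ordinal lt_jm); rewrite // inE -defij.
  exists (@stretch d m @^-1: A) => //; rewrite inE -(card_imset _ inj) -defA cA andbT.
  apply/arc_diagramP; split=> [i j|i j j'|i i' j]; rewrite !inE.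
  - by case/inc=> /=; lia.
  - by move=> h /(injr _ _ _ h) /(congr1 val) /= /addnI /val_inj.
  - by move=> h /(injl _ _ _ h) /(congr1 val) /= /val_inj.
rewrite inE => /andP[/arc_diagramP[inc injr injl] cA'] ->.
rewrite inE card_imset // cA' andbT; apply/arc_diagramP; split.
- by move=> i j /imsetP[[i' j'] /inc[h1 h2] [-> ->]] /=; lia.
- move=> i j j' /imsetP[[i1 j1] h1 [-> ->]] /imsetP[[i2 j2] h2 [] /val_inj e ->].
  by move: h2; rewrite -e => /(injr _ _ _ h1) ->.
- move=> i i' j /imsetP[[i1 j1] h1 [-> ->]] /imsetP[[i2 j2] h2 [->]].
  move=> /addnI /val_inj e.
  by move: h2; rewrite -e => /(injl _ _ _ h1) ->.
Qed.

Theorem theorem1p14 (n k r d : nat) (hkn : k <= n) (hrk : r <= k) (hdr : d < r) :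
  rd_stirling2 n k r d = r_stirling2 (n - d) (k - d) (r - d).
Proof.
have le_dn : d <= n by lia.
rewrite r_stirling2E !rd_stirling2_diagrams ?leq_sub2r //.
have -> : n - d - (k - d) = n - k by lia.
by rewrite -card_diagrams_shift subnKC.
Qed.
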